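(* For every $p\in(0,1)$ there is a $1$-sub-monotone algorithm for $p$-Faulty Search with expansion factor $\beta=1/(1-p)$ and competitive ratio $$R=\sqrt{(p-2)(p-1)\bigl(p(p(4p-3)+5)+2\bigr)}+\frac{4}{2-p}-(2-p)p .$$
   Context: Problem $p$-Faulty Search: a unit-speed robot starts at the origin of the half-line $[0,\infty)$; a treasure at unknown distance $d\ge1$ is detected independently with probability $p$ at each pass of the robot over it. $\mathbb{E}(d)$ is the expected time of first detection (i.e. $\sum_{i\ge1}p(1-p)^{i-1}f_i$, $f_i$ the time of the $i$-th pass over $d$), and the competitive ratio is $\sup_{d\ge1}p\,\mathbb{E}(d)/d$. A $1$-sub-monotone trajectory has parameters (expansion factor) $\beta>1$ and $1<\gamma_1<\beta$; with $x_r=\beta^r$, it first moves $0\to x_1\to0\to x_1$, then for $r=1,2,\dots$ moves $x_r\to\gamma_1x_r\to x_r\to\gamma_1x_r\to x_{r+1}\to0\to x_{r+1}$. *)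

(* Defs.v *)
(* MathComp-Analysis. *)
From HB Require Import structures.
From mathcomp Require Import all_boot all_order all_algebra.
From mathcomp Require Import all_classical all_reals all_analysis.

Set Implicit Arguments.
Unset Strict Implicit.
Unset Printing Implicit Defensive.

Import Order.TTheory GRing.Theory Num.Theory.
Import numFieldNormedType.Exports.

Local Open Scope classical_set_scope.
Local Open Scope ring_scope.

(* A piecewise linear unit-speed trajectory is encoded by the sequence
   w 0, w 1, ... of its successive endpoints: leg n goes from w n to w n.+1. *)

Definition elapsed (R : realType) (w : nat -> R) (n : nat) : R :=
  \sum_(0 <= i < n) `|w i.+1 - w i|.

(* The legs are closed: reaching d exactly at an endpoint is a visit of d, and
   the end of a leg and the start of the next one are the same instant. *)
Definition visits (R : realType) (w : nat -> R) (d : R) : set R :=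
  [set t | exists (n : nat) (s : R), [/\ 0 <= s <= 1,
     d = w n + s * (w n.+1 - w n) &
     t = elapsed w n + s * `|w n.+1 - w n|]].

(* Passes are numbered from 0; the time is +oo if the pass never happens. *)
Fixpoint pass_time (R : realType) (w : nat -> R) (d : R) (i : nat) : \bar R :=
  match i with
  | 0%N => ereal_inf [set t%:E | t in visits w d]
  | j.+1 => ereal_inf
      [set t%:E | t in [set t | visits w d t /\ (pass_time w d j < t%:E)%E]]
  end.

Definition expected_detection_time (R : realType) (p : R) (w : nat -> R)
    (d : R) : \bar R :=
  (\sum_(0 <= i <oo) ((p * (1 - p) ^+ i)%:E * pass_time w d i))%E.

Definition competitive_ratio (R : realType) (p : R) (w : nat -> R) : \bar R :=
  ereal_sup [set (p%:E * expected_detection_time p w d * (d^-1)%:E)%E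
            | d in [set d : R | 1 <= d]].

(* Endpoints 0, x_1, 0, x_1, followed for each r >= 1 by the six endpoints
   reached in round r, which starts at x_r = beta ^+ r. *)
Definition sub_monotone1_path (R : realType) (beta gamma1 : R) (n : nat) : R :=
  let x r := beta ^+ r in
  match n with
  | 0%N => 0
  | 1%N => x 1%N
  | 2%N => 0
  | 3%N => x 1%N
  | m.+4 => let r := (m %/ 6).+1 in
      nth 0 [:: gamma1 * x r; x r; gamma1 * x r; x r.+1; 0; x r.+1] (m %% 6)
  end.

Definition sub_monotone1 (R : realType) (beta : R) (w : nat -> R) : Prop :=
  1 < beta /\
  exists gamma1 : R, 1 < gamma1 < beta /\ w = sub_monotone1_path beta gamma1.

(* Main.v *)
(* Write q = 1 - p, beta = 1 / q and x_r = beta^r, and let g > 1 be the root of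
     q (p^2 - p + 2) g^2 = q (2 - p) g + p (2 - p).
   The time at which the robot starts round r is affine in x_r, and the passes
   over d during the later excursions to the origin contribute a geometric
   series, so p E(d) is affine in d and x_r on each of [x_r, g x_r) and
   [g x_r, x_(r+1)), with constant term -2 g.  On the second interval it equals
   kappa d + mu x_r - 2 g, so the ratio stays below kappa + mu / g and tends to
   it along d = g x_r + 1.  On the first interval the ratio is at most
   kappa_low + mu_low, which is smaller by 2 p q^3 (g - 1); the quadratic
   equation for g turns kappa + mu / g into the claimed closed form. *)
Require Import Defs.
From HB Require Import structures.
From mathcomp Require Import all_boot all_order all_algebra.
From mathcomp Require Import all_classical all_reals all_analysis.
From mathcomp Require Import ring lra zify.

Set Implicit Arguments.
Unset Strict Implicit.
Unset Printing Implicit Defensive.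

Import Order.TTheory GRing.Theory Num.Theory.
Import numFieldNormedType.Exports.

Local Open Scope classical_set_scope.
Local Open Scope ring_scope.

(** * Visits, pass times and expected detection time of an arbitrary trajectory *)

Section Trajectory.
Variables (R : realType) (w : nat -> R).
Implicit Types (d t p V : R) (f : nat -> R).

Lemma elapsed0 : elapsed w 0 = 0.
Proof. by rewrite /elapsed big_geq. Qed.

Lemma elapsedS n : elapsed w n.+1 = elapsed w n + `|w n.+1 - w n|.
Proof. by rewrite /elapsed big_nat_recr. Qed.

Lemma elapsed_ge0 n : 0 <= elapsed w n.
Proof. by rewrite /elapsed sumr_ge0. Qed.

Lemma visits_ge0 d t : visits w d t -> 0 <= t.
Proof.
move=> [n [s [/andP[s0 _] _ ->]]].
by rewrite addr_ge0 ?elapsed_ge0 // mulr_ge0.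
Qed.

Lemma visits_up n d : w n <= d <= w n.+1 -> w n < w n.+1 ->
  visits w d (elapsed w n + (d - w n)).
Proof.
move=> /andP[nd dn] lt; have w0 : 0 < w n.+1 - w n by rewrite subr_gt0.
exists n, ((d - w n) / (w n.+1 - w n)); split.
- by rewrite divr_ge0 ?subr_ge0 ?(ltW lt) //= ler_pdivrMr // mul1r lerD2r.
- by rewrite divfK ?gt_eqF // addrC subrK.
- by rewrite gtr0_norm // divfK ?gt_eqF.
Qed.

Lemma visits_down n d : w n.+1 <= d <= w n -> w n.+1 < w n ->
  visits w d (elapsed w n + (w n - d)).
Proof.
move=> /andP[nd dn] lt; have w0 : 0 < w n - w n.+1 by rewrite subr_gt0.
exists n, ((w n - d) / (w n - w n.+1)); split.
- by rewrite divr_ge0 ?subr_ge0 ?(ltW lt) //= ler_pdivrMr // mul1r lerB.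
- by field; rewrite gt_eqF.
- by rewrite distrC gtr0_norm // divfK ?gt_eqF.
Qed.

Lemma visits_leg d t : visits w d t -> exists n,
  Num.min (w n) (w n.+1) <= d <= Num.max (w n) (w n.+1) /\
  t = elapsed w n + `|d - w n|.
Proof.
move=> [n [s [/andP[s0 s1] -> ->]]]; exists n; split.
  by case: (leP (w n) (w n.+1)) => h; apply/andP; split; nra.
by rewrite addrC [w n + _]addrC addrK normrM (ger0_norm s0) addrC.
Qed.

Lemma pass_time_ge0 d i : (0 <= pass_time w d i)%E.
Proof.
by case: i => [|i]; apply: le_ereal_inf_tmp => _ [t + <-];
  [|case]; rewrite lee_fin => /visits_ge0.
Qed.

(** By induction [f i.+1] lies beyond pass [i], so it competes in the infimum defining the next
    pass. [f] may skip visits, which lets the upper bounds cover some turning points. *)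
Lemma pass_time_le d f : (forall i, visits w d (f i)) ->
  (forall i, f i < f i.+1) -> forall i, (pass_time w d i <= (f i)%:E)%E.
Proof.
move=> fv fi; elim=> [|i IH]; apply: ereal_inf_lbound.
  by exists (f 0%N).
exists (f i.+1) => //.
by split => //; apply: le_lt_trans IH _; rewrite lte_fin.
Qed.

(** Strict growth of [f] turns comparisons of times into comparisons of indices: a visit later than
    pass [i] is some [f j] with [j > i]. *)
Lemma pass_time_ge d f : (forall t, visits w d t -> exists i, t = f i) ->
  (forall i, f i < f i.+1) -> forall i, ((f i)%:E <= pass_time w d i)%E.
Proof.
move=> vf fi; have fm := homo_ltn lt_trans fi.
have fmi i j : (f i <= f j) = (i <= j)%N.
  by apply: (le_mono (f := f)) => ? ?; exact: fm.
elim=> [|i IH]; apply: le_ereal_inf_tmp => _ [t + <-].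
  by move=> /vf[j ->]; rewrite lee_fin fmi.
move=> [/vf[j ->]] /(le_lt_trans IH).
by rewrite lte_fin lee_fin fmi ltNge fmi -ltnNge.
Qed.

Lemma detection_term_ge0 p d i : 0 < p < 1 ->
  (0 <= (p * (1 - p) ^+ i)%:E * pass_time w d i)%E.
Proof.
move=> /andP[p0 p1]; rewrite mule_ge0 ?pass_time_ge0 // lee_fin.
by rewrite mulr_ge0 ?exprn_ge0 ?subr_ge0 // ltW.
Qed.

(** The terms are nonnegative, so partial sums increase and bounding them for arbitrarily large [m]
    is enough; later [m] always ends on a whole pair of passes. *)
Lemma expected_detection_time_le p d f V : 0 < p < 1 ->
  (forall i, (pass_time w d i <= (f i)%:E)%E) ->
  (forall n, exists2 m, (n <= m)%N &
     \sum_(0 <= i < m) p * (1 - p) ^+ i * f i <= V) ->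
  (expected_detection_time p w d <= V%:E)%E.
Proof.
move=> hp wf fV; have u0 i := detection_term_ge0 d i hp.
apply: lime_le; first exact: is_cvg_nneseries.
apply: nearW => n; have [m nm sV] := fV n.
have /= le_nm := @lee_sum_nneg_natr _ _ xpredT 0 (fun i _ _ => u0 i) _ _ nm.
apply: le_trans le_nm _.
apply: (@le_trans _ _ (\sum_(0 <= i < m) (p * (1 - p) ^+ i * f i)%:E)%E);
  last by rewrite sumEFin lee_fin.
apply: lee_sum => i _; rewrite [leRHS]EFinM; apply: lee_wpmul2l; rewrite ?lee_fin //.
by case/andP: hp => p0 p1; rewrite mulr_ge0 ?exprn_ge0 ?subr_ge0 // ltW.
Qed.

Lemma expected_detection_time_ge p d f V : 0 < p < 1 ->
  (forall i, ((f i)%:E <= pass_time w d i)%E) ->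
  (forall e, 0 < e -> exists m,
     V - e <= \sum_(0 <= i < m) p * (1 - p) ^+ i * f i) ->
  (V%:E <= expected_detection_time p w d)%E.
Proof.
move=> hp wf fV; have u0 i := detection_term_ge0 d i hp.
apply/lee_addgt0Pr => e /fV[m sV]; rewrite -leeBlDr // -EFinB.
apply: le_trans (nneseries_lim_ge m (fun i _ _ => u0 i)).
apply: (@le_trans _ _ (\sum_(0 <= i < m) (p * (1 - p) ^+ i * f i)%:E)%E);
  first by rewrite sumEFin lee_fin.
apply: lee_sum => i _; rewrite [leLHS]EFinM; apply: lee_wpmul2l; rewrite ?lee_fin //.
by case/andP: hp => p0 p1; rewrite mulr_ge0 ?exprn_ge0 ?subr_ge0 // ltW.
Qed.

End Trajectory.

(** * Endpoints and timing of the sub-monotone path *)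

Section SubMonotone.
(* [k] stands for 2 g / p; as a variable it keeps times polynomial. *)
Variables (R : realType) (b g k p : R).
Hypotheses (hp : 0 < p < 1) (qb : (1 - p) * b = 1) (hg : 1 < g < b).
Hypothesis kp : k * p = 2 * g.

Local Notation w := (sub_monotone1_path b g).

(** Cutting the path at the arrivals at x_(s+1) before each trip to the origin makes the initial
    legs fit the period six of the rounds; only endpoint 0 stays outside. *)
Lemma path_block s j : (j < 6)%N -> w (6 * s + j.+1) =
  nth 0 [:: b ^+ s.+1; 0; b ^+ s.+1; g * b ^+ s.+1; b ^+ s.+1; g * b ^+ s.+1] j.
Proof.
have w4 r i : (i < 6)%N -> w (6 * r + i).+4 =
    nth 0 [:: g * b ^+ r.+1; b ^+ r.+1; g * b ^+ r.+1; b ^+ r.+2; 0; b ^+ r.+2] i.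
  move=> i6; rewrite /= mulnC divnMDl // modnMDl divn_small // modn_small //.
  by rewrite addn0.
(* Positions 3 to 5 belong to round [s.+1]; positions 0 to 2 close round [s], or are initial
   endpoints when [s = 0]. *)
case: j => [|[|[|j]]] j6; last first.
- rewrite (_ : (6 * s + j.+4 = (6 * s + j).+4)%N); last by lia.
  by rewrite w4; [move: j6; do 3 (case: j => // j)|lia].
all: case: s => [|s]; first by rewrite muln0.
- by rewrite (_ : (6 * s.+1 + 3 = (6 * s + 5).+4)%N) ?w4 //; lia.
- by rewrite (_ : (6 * s.+1 + 2 = (6 * s + 4).+4)%N) ?w4 //; lia.
- by rewrite (_ : (6 * s.+1 + 1 = (6 * s + 3).+4)%N) ?w4 //; lia.
Qed.

Lemma b_gt1 : 1 < b. Proof. by case/andP: hg; exact: lt_trans. Qed.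

Lemma x_ge1 r : 1 <= b ^+ r.
Proof. by rewrite exprn_ege1 // ltW // b_gt1. Qed.

(* The time at which round r starts at x_r; [start 0] extrapolates this to the
   target distances in [1, x_1), which are scanned before round 1. *)
Definition start r : R := 3 * b ^+ r + k * ((1 - p) * b ^+ r - 1).

(** In units of x_r a round has length 3 (g - 1) + (b - g) + 2 b. The relations [qb] and [kp] make
    the closed form of [start] solve this recurrence. *)
Lemma startS r : start r.+1 = start r + b ^+ r * (2 * g - 3 + 3 * b).
Proof.
rewrite /start exprS; set x := b ^+ r.
have -> : (1 - p) * (b * x) = x by rewrite mulrA qb mul1r.
by rewrite -kp; ring.
Qed.

(** The arrival at x_(s+1) precedes the start of the round by the return trip to the origin. *)
Lemma elapsed_block s : elapsed w (6 * s + 1) = start s.+1 - 2 * b ^+ s.+1.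
Proof.
have b0 : 0 < b by apply: lt_trans b_gt1.
case/andP: hg => g1 gb.
elim: s => [|s IH].
  have w1 : w 1 = b ^+ 1 by [].
  rewrite elapsedS elapsed0 w1 expr1 subr0 add0r gtr0_norm // /start.
  by rewrite expr1 qb subrr mulr0 addr0; ring.
rewrite (_ : (6 * s.+1 + 1 = 6 * s + 7)%N); last by lia.
have w7 : w (7 + 6 * s) = b ^+ s.+2.
  by rewrite (_ : (7 + 6 * s = 6 * s.+1 + 1)%N) ?path_block //; lia.
have wj j : w (j.+1 + 6 * s) = w (6 * s + j.+1) by rewrite addnC.
rewrite addnC in IH; rewrite addnC 6!elapsedS -[(6 * s).+1]/(1 + 6 * s)%N IH.
rewrite (startS s.+1) w7 (wj 0) (wj 1) (wj 2) (wj 3) (wj 4) (wj 5).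
rewrite !path_block //=.
rewrite (exprS b s.+1); set x := b ^+ s.+1.
have x0 : 0 < x by exact: exprn_gt0.
have nl : `|0 - x| = x by rewrite sub0r normrN gtr0_norm.
have nr : `|x - 0| = x by rewrite subr0 gtr0_norm.
have ng : `|g * x - x| = g * x - x by rewrite gtr0_norm // subr_gt0; nra.
have nb : `|b * x - g * x| = b * x - g * x.
  by rewrite gtr0_norm // subr_gt0; nra.
by rewrite nl nr (distrC x) ng nb; ring.
Qed.

Lemma elapsed_leg s j : (j < 6)%N -> elapsed w (6 * s + j.+1) = start s.+1 +
  b ^+ s.+1 * nth 0 [:: -2; -1; 0; g - 1; 2 * (g - 1); 3 * (g - 1)] j.
Proof.
have x0 : 0 < b ^+ s.+1 by rewrite exprn_gt0 // (lt_trans ltr01 b_gt1).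
case/andP: hg => g1 gb.
have leg j' : (j'.+1 < 6)%N -> elapsed w (6 * s + j'.+2) =
    elapsed w (6 * s + j'.+1) + `|w (6 * s + j'.+2) - w (6 * s + j'.+1)|.
  by rewrite !addnS elapsedS.
have e1 : `|0 - b ^+ s.+1| = b ^+ s.+1 by rewrite sub0r normrN gtr0_norm.
have e2 : `|b ^+ s.+1 - 0| = b ^+ s.+1 by rewrite subr0 gtr0_norm.
have e3 : `|g * b ^+ s.+1 - b ^+ s.+1| = (g - 1) * b ^+ s.+1.
  by rewrite gtr0_norm ?subr_gt0; [ring|nra].
have e4 : `|b ^+ s.+1 - g * b ^+ s.+1| = (g - 1) * b ^+ s.+1 by rewrite distrC.
case: j => [_|j]; first by rewrite elapsed_block /=; ring.
elim: j => [|j IH] j6; rewrite leg //.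
  by rewrite elapsed_block !path_block //= e1; ring.
rewrite IH ?(ltnW j6) // !path_block ?(ltnW j6) //.
by clear IH; move: j6; do 4 (case: j => [_|j] /=; first by rewrite ?e1 ?e2 ?e3 ?e4; ring).
Qed.

(** * Enumeration of the passes over a target *)

(* Midpoint of the two passes over a target while the robot goes from x_r to
   the origin and back. *)
Definition origin_time r : R := start r - b ^+ r.

(** [h] holds the passes before the trip to the origin from x_(r+1). From then on each trip gives a
    pair: downward for even [j], upward for odd [j]. *)
Definition passes (h : seq R) r d i : R :=
  if (i < size h)%N then h`_i
  else let j := (i - size h)%N in
    origin_time (r.+1 + j./2) + (-1) ^+ (~~ odd j) * d.

Lemma visits_origin s d : 0 < d <= b ^+ s.+1 ->
  visits w d (origin_time s.+1 - d) /\ visits w d (origin_time s.+1 + d).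
Proof.
move=> /andP[d0 dx]; have x0 := lt_le_trans d0 dx.
have wd : w (6 * s + 1).+1 = 0 by rewrite -addnS path_block.
have wu : w (6 * s + 2).+1 = b ^+ s.+1 by rewrite -addnS path_block.
have := @visits_down _ w (6 * s + 1) d; have := @visits_up _ w (6 * s + 2) d.
rewrite wd wu !elapsed_leg // !path_block //= => vu vd; split.
- rewrite (_ : _ - d = start s.+1 + b ^+ s.+1 * -2 + (b ^+ s.+1 - d)).
    by apply: vd => //; rewrite ltW.
  by rewrite /origin_time; ring.
- rewrite (_ : _ + d = start s.+1 + b ^+ s.+1 * -1 + (d - 0)).
    by apply: vu => //; rewrite ltW.
  by rewrite /origin_time; ring.
Qed.

Lemma le_expb m n : (m <= n)%N -> b ^+ m <= b ^+ n.
Proof. by apply: ler_weXn2l; rewrite ltW // b_gt1. Qed.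

Lemma visits_passes h r d : 0 < d <= b ^+ r.+1 ->
  (forall t, t \in h -> visits w d t) -> forall i, visits w d (passes h r d i).
Proof.
move=> /andP[d0 dx] hv i; rewrite /passes; case: ltnP => ih.
  by apply: hv; exact: mem_nth.
set j := (i - _)%N; have [] := @visits_origin (r + j./2) d.
  by rewrite d0 (le_trans dx) // le_expb // ltnS leq_addr.
by rewrite addSn; case: (odd j); rewrite ?expr0 ?expr1 ?mul1r ?mulN1r.
Qed.

Lemma k_ge0 : 0 <= k.
Proof.
by case/andP: hp => p0 _; rewrite -(pmulr_lge0 _ p0) kp; case/andP: hg; lra.
Qed.

(** Past [h], the passes of a pair are 2 d apart, and two successive pairs are separated by 2 x (b +
    g - 1) - 2 d, positive because d <= x. *)
Lemma passes_lt h r d : 0 < d <= b ^+ r.+1 ->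
  sorted <%R (rcons h (origin_time r.+1 - d)) ->
  forall i, passes h r d i < passes h r d i.+1.
Proof.
move=> /andP[d0 dx] hs i; rewrite /passes.
have hn n : (n <= size h)%N -> (if (n < size h)%N then h`_n else
    let j := (n - size h)%N in
    origin_time (r.+1 + j./2) + (-1) ^+ (~~ odd j) * d) =
    (rcons h (origin_time r.+1 - d))`_n.
  rewrite nth_rcons leq_eqVlt => /orP[/eqP->|->//].
  by rewrite ltnn eqxx subnn /= expr1 mulN1r addn0.
have [ih|hi] := ltnP i (size h).
  have := hn i.+1 ih; have := hn i (ltnW ih); rewrite ih => -> ->.
  by apply: (sortedP 0 hs); rewrite size_rcons.
rewrite ltnNge (leqW hi) /= subSn //= -/(uphalf _) uphalf_half.
set j := (i - _)%N; case: (odd j) => /=; last first.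
  by rewrite add0n expr0 expr1; nra.
rewrite add1n addnS expr0 expr1 /origin_time startS exprS.
have := x_ge1 (r + j./2).+1; have : b ^+ r.+1 <= b ^+ (r.+1 + j./2).
  by rewrite le_expb // leq_addr.
rewrite -addSn; set x := b ^+ (r.+1 + _) => dx' x1.
have x0 : 0 < x by lra.
have xb : 0 < x * (b - 1) by rewrite mulr_gt0 // subr_gt0 b_gt1.
have xg : 0 < x * (g - 1) by case/andP: hg => g1 _; rewrite mulr_gt0 // subr_gt0.
lra.
Qed.

(** * The geometric series of the passes near the origin *)

(* Up to the factor q^(size h), what the passes of index at least
   size h + 2 n contribute to the expected detection time. *)
Definition tail r d n : R :=
  (1 - p) ^+ (2 * n) * ((2 - p) * (2 + k * (1 - p)) * b ^+ (r.+1 + n) - k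
                        - p * d / (2 - p)).

(** Telescoping form of the series: from one pair to the next the weight gains q^2, so the part in
    x_r gains q^2 b = q and the parts in [k] and [d] gain q^2. *)
Lemma tailB r d n : tail r d n - tail r d n.+1 =
  p * (1 - p) ^+ (2 * n) * (origin_time (r.+1 + n) - d) +
  p * (1 - p) ^+ (2 * n).+1 * (origin_time (r.+1 + n) + d).
Proof.
have [p0 p1] := andP hp; have q0 : 1 - p != 0 by rewrite subr_eq0 gt_eqF.
have bE : b = (1 - p)^-1 by apply: (mulfI q0); rewrite qb divff.
rewrite /tail /origin_time /start (_ : 2 * n.+1 = (2 * n).+2)%N; last by lia.
rewrite addnS (exprS b) 2!(exprS (1 - p)).
set Q := _ ^+ (2 * n); set x := b ^+ (r.+1 + n).
by clearbody Q x; rewrite bE; field; rewrite q0 /= gt_eqF //; lra.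
Qed.

Lemma passes_down h r d n :
  passes h r d (size h + 2 * n) = origin_time (r.+1 + n) - d.
Proof.
by rewrite /passes ltnNge leq_addr addKn mul2n doubleK odd_double expr1 mulN1r.
Qed.

Lemma passes_up h r d n :
  passes h r d (size h + 2 * n).+1 = origin_time (r.+1 + n) + d.
Proof.
rewrite /passes -addnS ltnNge leq_addr addKn mul2n /= uphalf_double odd_double.
by rewrite expr0 mul1r.
Qed.

Lemma sum_passes h r d n :
  \sum_(0 <= i < size h + 2 * n) p * (1 - p) ^+ i * passes h r d i =
  \sum_(0 <= i < size h) p * (1 - p) ^+ i * h`_i +
  (1 - p) ^+ size h * (tail r d 0 - tail r d n).
Proof.
elim: n => [|n IH].
  rewrite addn0 subrr mulr0 addr0; apply: eq_big_nat => i /andP[_ ih].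
  by rewrite /passes ih.
rewrite (_ : _ + 2 * n.+1 = (size h + 2 * n).+2)%N; last by lia.
rewrite !big_nat_recr //= IH passes_down passes_up -addnS 2!(exprD _ (size h)).
have -> : tail r d 0 - tail r d n.+1 = tail r d 0 - tail r d n +
  (tail r d n - tail r d n.+1) by rewrite [RHS]addrA subrK.
by rewrite tailB; ring.
Qed.

(** Makes the limit bound all the partial sums of [sum_passes]. As q x >= 1 for x = x_(r+1+n), the
    term in k q x outweighs [k], and 2 (2 - p) x outweighs p d / (2 - p). *)
Lemma tail_ge0 r d n : 0 < d <= b ^+ r.+1 -> 0 <= tail r d n.
Proof.
move=> /andP[d0 dx]; have [p0 p1] := andP hp; have k0 := k_ge0.
rewrite /tail mulr_ge0 ?exprn_ge0 ?subr_ge0 ?(ltW p1) //.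
have hx : b ^+ r.+1 <= b ^+ (r.+1 + n) by rewrite le_expb // leq_addr.
have : 1 <= (1 - p) * b ^+ (r.+1 + n).
  by rewrite addSn exprS mulrA qb mul1r x_ge1.
have : p * d / (2 - p) <= d by rewrite ler_pdivrMr; nra.
move: hx; set x := b ^+ (r.+1 + n); set t := p * d / _ => hx ht qx.
have : 0 <= (2 - p) * k * ((1 - p) * x - 1).
  by rewrite !mulr_ge0 ?subr_ge0 //; lra.
have : 0 <= k * (1 - p) by rewrite mulr_ge0 ?subr_ge0 ?(ltW p1).
have : 0 <= x * (1 - p) by rewrite mulr_ge0 ?subr_ge0 ?(ltW p1) //; lra.
lra.
Qed.

(** The remainder vanishes in the limit, because q^(2n) b^n = q^n. *)
Lemma tail_le r d n : 0 < d ->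
  tail r d n <= (2 - p) * (2 + k * (1 - p)) * b ^+ r.+1 * (1 - p) ^+ n.
Proof.
move=> d0; have [p0 p1] := andP hp; have k0 := k_ge0.
have Qge0 : 0 <= (1 - p) ^+ (2 * n) by rewrite exprn_ge0 // subr_ge0 ltW.
have e : (1 - p) ^+ n = (1 - p) ^+ (2 * n) * b ^+ n.
  by rewrite mul2n -addnn exprD -mulrA -exprMn qb expr1n mulr1.
rewrite e /tail (exprD b); set Q := (1 - p) ^+ (2 * n) in Qge0 *.
rewrite [leRHS](_ : _ = Q * ((2 - p) * (2 + k * (1 - p)) * (b ^+ r.+1 * b ^+ n)));
  last by ring.
rewrite ler_wpM2l //.
have : 0 <= p * d / (2 - p) by rewrite divr_ge0 ?mulr_ge0; lra.
lra.
Qed.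

Lemma expb_unbounded (M : R) : exists n, M <= b ^+ n.
Proof.
have b1 := b_gt1; have d0 : 0 < b - 1 by rewrite subr_gt0.
have bern n : 1 + n%:R * (b - 1) <= b ^+ n.
  elim: n => [|n IH]; first by rewrite mul0r addr0 expr0.
  rewrite exprS -natr1; have : 0 <= n%:R * (b - 1) by rewrite mulr_ge0 // ltW.
  have : 0 <= (b - 1) * (b ^+ n - (1 + n%:R * (b - 1))).
    by rewrite mulr_ge0 ?subr_ge0 // ltW.
  have : 0 <= (b - 1) * (n%:R * (b - 1)) by rewrite !mulr_ge0 // ltW.
  lra.
pose y := M / (b - 1); exists (Num.bound `|y|); apply: le_trans (bern _).
have : y * (b - 1) <= (Num.bound `|y|)%:R * (b - 1).
  rewrite ler_wpM2r ?(ltW d0) // (le_trans (ler_norm y)) //.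
  by rewrite ltW // archi_boundP.
by rewrite /y divfK ?gt_eqF //; lra.
Qed.

Lemma detection_le h r d : 0 < d <= b ^+ r.+1 ->
  sorted <%R (rcons h (origin_time r.+1 - d)) ->
  (forall t, t \in h -> visits w d t) ->
  (expected_detection_time p w d <=
     (\sum_(0 <= i < size h) p * (1 - p) ^+ i * h`_i +
      (1 - p) ^+ size h * tail r d 0)%:E)%E.
Proof.
move=> hd hs hv; have [p0 p1] := andP hp.
apply: (expected_detection_time_le (f := passes h r d) hp).
  by apply: pass_time_le; [exact: visits_passes|exact: passes_lt].
move=> n; exists (size h + 2 * n)%N; first by lia.
rewrite sum_passes lerD2l ler_wpM2l ?exprn_ge0 ?subr_ge0 ?(ltW p1) //.
by rewrite gerBl tail_ge0.
Qed.

Lemma detection_ge h r d : 0 < d <= b ^+ r.+1 ->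
  sorted <%R (rcons h (origin_time r.+1 - d)) ->
  (forall t, visits w d t -> exists i, t = passes h r d i) ->
  ((\sum_(0 <= i < size h) p * (1 - p) ^+ i * h`_i +
      (1 - p) ^+ size h * tail r d 0)%:E <= expected_detection_time p w d)%E.
Proof.
move=> hd hs hv; have [p0 p1] := andP hp; have [d0 _] := andP hd.
apply: (expected_detection_time_ge (f := passes h r d) hp).
  by apply: pass_time_ge => //; exact: passes_lt.
move=> e e0; set C := (2 - p) * (2 + k * (1 - p)) * b ^+ r.+1.
(* C <= e b^n is equivalent to C q^n <= e, the bound on the remainder. *)
have [n Cn] := expb_unbounded (C / e); exists (size h + 2 * n)%N.
rewrite sum_passes mulrBr addrA lerB //.
have q01 : 0 <= (1 - p) ^+ size h <= 1.
  by rewrite exprn_ge0 ?exprn_ile1 //; lra.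
have : (1 - p) ^+ size h * tail r d n <= tail r d n.
  by rewrite ler_piMl ?tail_ge0 //; case/andP: q01.
move=> /le_trans; apply; apply: le_trans (tail_le _ _ d0) _; rewrite -/C.
rewrite ler_pdivrMr // in Cn; apply: le_trans (ler_wpM2r _ Cn) _.
  by rewrite exprn_ge0 // subr_ge0 ltW.
by rewrite mulrAC -exprMn (mulrC b) qb expr1n mul1r.
Qed.

(** * Targets between g x_r and x_(r+1) *)

Lemma origin_timeS r :
  origin_time r.+1 = start r + b ^+ r * (2 * g - 3 + 2 * b).
Proof. by rewrite /origin_time startS exprS; ring. Qed.

Definition kappa : R := p ^+ 2 / (2 - p).
Definition mu : R := 2 * g * p + 2 * g * (1 - p) * (2 - p) + 2 * p * (2 - p).

(** The single early pass is on the leg from g x_r to x_(r+1), at [start r] + 3 (g - 1) x_r + (d - g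
    x_r). *)
Lemma cost_high r d :
  p * (p * (start r + (2 * g - 3) * b ^+ r + d) + (1 - p) * tail r d 0) =
  kappa * d + mu * b ^+ r - 2 * g.
Proof.
have [p0 p1] := andP hp.
rewrite /tail muln0 expr0 mul1r addn0 (exprS b) /start /kappa /mu.
have bE : (1 - p) * (b * b ^+ r) = b ^+ r by rewrite mulrA qb mul1r.
set x := b ^+ r in bE *.
have -> : (1 - p) * ((2 - p) * (2 + k * (1 - p)) * (b * x) - k - p * d / (2 - p))
  = (2 - p) * (2 + k * (1 - p)) * x - (1 - p) * (k + p * d / (2 - p)).
  by rewrite -[in RHS]bE; ring.
have kE : k = 2 * g / p by rewrite -kp mulfK // gt_eqF.
by clearbody x; rewrite kE; field; rewrite !gt_eqF //; lra.
Qed.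

(* For r = 0 the cost of round 0 extrapolates to the whole of [1, x_1). *)
Lemma detection_high r d : 1 <= d < b ^+ r.+1 -> ((0 < r)%N -> g * b ^+ r <= d) ->
  (p%:E * expected_detection_time p w d <= (kappa * d + mu * b ^+ r - 2 * g)%:E)%E.
Proof.
move=> hd hr; have [p0 p1] := andP hp; have [g1 gb] := andP hg.
have [d1 d2] := andP hd; have x0 := lt_le_trans ltr01 (x_ge1 r).
set t := start r + (2 * g - 3) * b ^+ r + d.
rewrite -cost_high EFinM lee_pmul2l // -[p * _]mulr1 -/t.
apply: le_trans (@detection_le [:: t] r d _ _ _) _.
- by rewrite (ltW d2) andbT; lra.
- by rewrite /= andbT origin_timeS /t; move: d2; rewrite exprS; lra.
- move=> _ /[!inE] /eqP ->; case: r hr {hd} @t x0 d2 => [_|s /(_ isT) hs] t x0 d2.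
    have w1 : w 1 = b by rewrite -[RHS]expr1.
    have := @visits_up _ w 0 d; rewrite elapsed0 w1 expr1 in d2 * => vt.
    (* [start 0] is 3 - k p = 3 - 2 g, so [t] equals [d], the time of the pass on the very first
       leg. *)
    rewrite /t (_ : _ + d = 0 + (d - w 0)); first by apply: vt => /=; lra.
    by rewrite /= /start !expr0; have := kp; lra.
  have := @visits_up _ w (6 * s + 6) d.
  rewrite (_ : (6 * s + 6).+1 = 6 * s.+1 + 1)%N; last by lia.
  rewrite !path_block // elapsed_leg //= hs (ltW d2) => /(_ isT) vt.
  rewrite /t (_ : _ + d = start s.+1 + b ^+ s.+1 * (3 * (g - 1)) +
    (d - g * b ^+ s.+1)); last by ring.
  by apply: vt; rewrite [ltRHS]exprS; nra.
by rewrite lee_fin big_nat1 expr0 expr1 !mulr1.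
Qed.

(** A search leg by leg. Before block [r], only the last leg of block [r - 1] reaches [d]; from
    block [r] on, only the two legs touching the origin do. Strict bounds keep [d] off the turning
    points. *)
Lemma visits_high r d t : (0 < r)%N -> g * b ^+ r < d < b ^+ r.+1 ->
  visits w d t ->
  exists i, t = passes [:: start r + (2 * g - 3) * b ^+ r + d] r d i.
Proof.
move=> r0 /andP[d1 d2] /visits_leg[n [hn ->]]; have [g1 gb] := andP hg.
have x0 m : 0 < b ^+ m := lt_le_trans ltr01 (x_ge1 m).
have gx m : (m <= r)%N -> b ^+ m < d /\ g * b ^+ m < d.
  move=> /le_expb; have := x0 m; have := x0 r; nra.
have xd m : (r < m)%N -> d < b ^+ m.
  by move=> /le_expb; exact: lt_le_trans.
case: n hn => [|n] hn.
  have [bd _] := gx 1%N r0; rewrite expr1 in bd.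
  have w0 : w 0 = 0 by [].
  have w1 : w 1 = b by rewrite -[RHS]expr1.
  have b1 := b_gt1.
  by move: hn; rewrite le_max w0 w1 => /andP[_ /orP[]]; lra.
set m := (n %/ 6)%N; set j := (n %% 6)%N.
have nE : n.+1 = (6 * m + j.+1)%N by rewrite addnS mulnC -divn_eq.
have j6 : (j < 6)%N by rewrite ltn_mod.
rewrite nE -addnS in hn *; clearbody m j; clear n nE.
rewrite elapsed_leg // path_block //.
(* For [j = 5] the leg ends at the first endpoint of the next block. *)
have wS : w (6 * m + j.+2) =
    nth 0 [:: 0; b ^+ m.+1; g * b ^+ m.+1; b ^+ m.+1; g * b ^+ m.+1; b ^+ m.+2] j.
  case: (ltnP j 5) => j5; first rewrite path_block //.
    by clear hn; do 5 (case: j j6 j5 => [//|j] j6 j5).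
  rewrite (_ : j = 5%N); last by lia.
  by rewrite (_ : 6 * m + 7 = 6 * m.+1 + 1)%N ?path_block //; lia.
rewrite wS path_block // le_max ge_min in hn; clear wS.
have xg : b ^+ m.+1 < g * b ^+ m.+1 by rewrite ltr_pMl.
have [mr|rm] := ltnP m r.
  have [b1 b2] := gx m.+1 mr; have d0 : 0 < d by apply: lt_trans (x0 m.+1) b1.
  have d0' : (d <= 0) = false by rewrite leNgt d0.
  have d3 : (d <= b ^+ m.+1) = false by rewrite leNgt b1.
  have d4 : (d <= g * b ^+ m.+1) = false by rewrite leNgt b2.
  move: hn j6; do 5 (case: j => [|j] /=;
    first by rewrite ?d0' ?d3 ?d4 ?orbF ?andbF).
  case: j => [|//] /= hn _; move: hn; rewrite d4 /= => /andP[_ hn].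
  have [mr2|rm2] := ltnP m.+1 r.
    by have [+ _] := gx _ mr2; rewrite ltNge hn.
  have -> : r = m.+1 by lia.
  exists 0%N; rewrite /passes /= gtr0_norm ?subr_gt0 //; ring.
have dm := xd m.+1 rm; have d0 : 0 < d.
  by apply: lt_trans d1; rewrite mulr_gt0 // (lt_trans ltr01).
have xm := lt_trans dm xg; have xm2 := xd m.+2 (leqW rm).
have h1 : (b ^+ m.+1 <= d) = false by rewrite leNgt dm.
have h2 : (g * b ^+ m.+1 <= d) = false by rewrite leNgt xm.
have h3 : (b ^+ m.+2 <= d) = false by rewrite leNgt xm2.
case: j j6 hn => [|[|j]] j6 hn.
- exists (size [:: start r + (2 * g - 3) * b ^+ r + d]%R + 2 * (m - r))%N.
  rewrite passes_down addSn subnKC // distrC gtr0_norm ?subr_gt0 //.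
  by rewrite /origin_time /=; ring.
- exists (size [:: start r + (2 * g - 3) * b ^+ r + d]%R + 2 * (m - r)).+1.
  rewrite passes_up addSn subnKC // subr0 gtr0_norm //.
  by rewrite /origin_time /=; ring.
- by move: hn j6; do 4 (case: j => [|j] /=; first by rewrite ?h1 ?h2 ?h3).
Qed.

Lemma detection_high_eq r d : (0 < r)%N -> g * b ^+ r < d < b ^+ r.+1 ->
  (p%:E * expected_detection_time p w d = (kappa * d + mu * b ^+ r - 2 * g)%:E)%E.
Proof.
move=> r0 hd; have [p0 p1] := andP hp; have [g1 gb] := andP hg.
have [d1 d2] := andP hd; have x1 := x_ge1 r.
have d3 : 1 <= d by nra.
apply/eqP; rewrite eq_le detection_high ?d3 //=; last by rewrite ltW.
set t := start r + (2 * g - 3) * b ^+ r + d.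
rewrite -cost_high EFinM lee_pmul2l // -/t.
apply: le_trans (@detection_ge [:: t] r d _ _ _).
- by rewrite lee_fin big_nat1 expr0 expr1 !mulr1.
- by rewrite (ltW d2) andbT; lra.
- by rewrite /= andbT origin_timeS /t; move: d2; rewrite exprS; lra.
- by move=> u; exact: visits_high.
Qed.

(** * Targets between x_r and g x_r *)

Definition kappa_low : R :=
  p ^+ 2 * (p + (1 - p) ^+ 2 - (1 - p) ^+ 3 / (2 - p)).
Definition mu_low : R :=
  2 * p ^+ 2 * (2 - p) * (1 + g * (1 - p)) +
  2 * g * p * (1 - p) * (1 + (1 - p) * (2 - p)) +
  2 * p * (1 - p) ^+ 2 * (2 - p) + 2 * g * (1 - p) ^+ 3 * (2 - p).

(** The three early passes are those on the legs x_r to g x_r, back to x_r, and again to g x_r. *)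
Lemma cost_low r d :
  p * (p * (start r + d - b ^+ r) +
       p * (1 - p) * (start r + 2 * g * b ^+ r - b ^+ r - d) +
       p * (1 - p) ^+ 2 * (start r + (2 * g - 3) * b ^+ r + d) +
       (1 - p) ^+ 3 * tail r d 0) =
  kappa_low * d + mu_low * b ^+ r - 2 * g.
Proof.
have [p0 p1] := andP hp.
rewrite /tail muln0 expr0 mul1r addn0 (exprS b) /start /kappa_low /mu_low.
have bE : (1 - p) * (b * b ^+ r) = b ^+ r by rewrite mulrA qb mul1r.
set x := b ^+ r in bE *.
have -> : (1 - p) ^+ 3 *
    ((2 - p) * (2 + k * (1 - p)) * (b * x) - k - p * d / (2 - p))
  = (1 - p) ^+ 2 * (2 - p) * (2 + k * (1 - p)) * x
    - (1 - p) ^+ 3 * (k + p * d / (2 - p)).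
  by rewrite -[in RHS]bE; ring.
have kE : k = 2 * g / p by rewrite -kp mulfK // gt_eqF.
by clearbody x; rewrite kE; field; rewrite !gt_eqF //; lra.
Qed.

(* At d = x_r itself the pass sequence is different, since x_r is a turning
   point, but it is dominated termwise by the limit of the sequences for
   d > x_r. *)
Lemma detection_low s d : b ^+ s.+1 <= d < g * b ^+ s.+1 ->
  (p%:E * expected_detection_time p w d <=
   (kappa_low * d + mu_low * b ^+ s.+1 - 2 * g)%:E)%E.
Proof.
move=> /andP[d1 d2]; have [p0 p1] := andP hp; have [g1 gb] := andP hg.
have b1 := b_gt1; have xr := x_ge1 s.+1; have x0 : 0 < b ^+ s.+1 by lra.
have d3 : d < b ^+ s.+2 by rewrite exprS; nra.
have hd : 0 < d <= b ^+ s.+2 by rewrite (ltW d3) andbT; lra.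
have e3 : w (6 * s + 3) = b ^+ s.+1 by rewrite path_block.
have e4 : w (6 * s + 4) = g * b ^+ s.+1 by rewrite path_block.
have e5 : w (6 * s + 5) = b ^+ s.+1 by rewrite path_block.
have e6 : w (6 * s + 6) = g * b ^+ s.+1 by rewrite path_block.
have v3 : visits w d (start s.+1 + d - b ^+ s.+1).
  have := @visits_up _ w (6 * s + 3) d; rewrite -addnS e3 e4 elapsed_leg //=.
  by rewrite mulr0 addr0 addrA; apply; rewrite ?d1 ?(ltW d2) //; nra.
have v5 : visits w d (start s.+1 + (2 * g - 3) * b ^+ s.+1 + d).
  have := @visits_up _ w (6 * s + 5) d; rewrite -addnS e5 e6 elapsed_leg //=.
  rewrite (_ : _ + (d - _) = start s.+1 + (2 * g - 3) * b ^+ s.+1 + d); last by ring.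
  by apply; rewrite ?d1 ?(ltW d2) //; nra.
have bs : b ^+ s.+2 = b * b ^+ s.+1 by rewrite exprS.
rewrite -cost_low EFinM lee_pmul2l //.
move: d1; rewrite le_eqVlt => /orP[/eqP dE|d1].
  (* With T = [start s.+1] and x = x_(s+1), the early passes for d > x tend to T, T + 2 (g - 1) x
     and T + 2 (g - 1) x; the visits listed here are no later, term by term. *)
  set h := [:: start s.+1 - 2 * b ^+ s.+1; start s.+1;
               start s.+1 + 2 * (g - 1) * b ^+ s.+1].
  apply: le_trans (@detection_le h s.+1 d hd _ _) _.
  - rewrite /= andbT origin_timeS -dE; apply/and3P; split; nra.
  - move=> t; rewrite !inE => /or3P[] /eqP ->.
    + have := @visits_down _ w (6 * s + 1) d.
      rewrite -addnS !path_block // elapsed_leg //= -dE subrr addr0.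
      rewrite (_ : _ + _ * -2 = start s.+1 - 2 * b ^+ s.+1); last by ring.
      by apply; rewrite // ltW // lexx.
    + by move: v3; rewrite -dE addrK.
    + move: v5; rewrite -dE (_ : _ + b ^+ s.+1 = start s.+1 + 2 * (g - 1) * b ^+ s.+1) //.
      by ring.
  rewrite lee_fin lerD2r /h /= !big_nat_recr ?big_geq //= -dE add0r expr0 expr1 !mulr1.
  have q0 : 0 < p * (1 - p) by rewrite mulr_gt0 // subr_gt0.
  set q2 := p * (1 - p) ^+ 2; set x := b ^+ s.+1 in x0 *; set T := start s.+1.
  rewrite [leRHS](_ : _ = p * T + p * (1 - p) * (T + 2 * (g - 1) * x) +
    q2 * (T + 2 * (g - 1) * x)); last by rewrite /q2; ring.
  have : 0 <= p * x by rewrite mulr_ge0 // ltW.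
  have : 0 <= p * (1 - p) * ((g - 1) * x).
    by rewrite !mulr_ge0 ?subr_ge0 // ltW.
  nra.
set h := [:: start s.+1 + d - b ^+ s.+1;
             start s.+1 + 2 * g * b ^+ s.+1 - b ^+ s.+1 - d;
             start s.+1 + (2 * g - 3) * b ^+ s.+1 + d].
apply: le_trans (@detection_le h s.+1 d hd _ _) _.
- rewrite /= andbT origin_timeS; apply/and3P; split; nra.
- move=> t; rewrite !inE => /or3P[] /eqP -> //.
  have := @visits_down _ w (6 * s + 4) d; rewrite -addnS e4 e5 elapsed_leg //=.
  rewrite (_ : _ + (_ - d) = start s.+1 + 2 * g * b ^+ s.+1 - b ^+ s.+1 - d);
    last by ring.
  by apply; rewrite ?(ltW d1) ?(ltW d2) //; nra.
by rewrite lee_fin lerD2r /h /= !big_nat_recr ?big_geq //= add0r expr0 expr1 !mulr1.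
Qed.

(** * The supremum of the ratio *)

Lemma scale_exists (d : R) : 1 <= d -> exists r, b ^+ r <= d < b ^+ r.+1.
Proof.
move=> d1; have b0 : 0 < b by apply: lt_trans b_gt1.
have ex : exists n, d < b ^+ n.+1.
  have [n nd] := expb_unbounded d; exists n; apply: le_lt_trans nd _.
  by rewrite exprS ltr_pMl ?b_gt1 // exprn_gt0.
case: (ex_minnP ex) => -[|r] dr min_r; first by exists 0%N; rewrite expr0 d1.
by exists r.+1; rewrite dr andbT leNgt; apply/negP => /min_r; rewrite ltnn.
Qed.

Hypothesis hF : (1 - p) * (p ^+ 2 - p + 2) * g ^+ 2 =
  (2 - p) * (1 - p) * g + p * (2 - p).

Let ratio := kappa + mu / g.

(** The equation [hF] trades the constant 2 p (2 - p) of [mu] for multiples of [g] and g^2, so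
    dividing by [g] leaves an affine expression. *)
Lemma mu_div_g : mu / g = 2 * (1 - p) * (p ^+ 2 - p + 2) * g + 2 * p.
Proof.
have g0 : g != 0 by case/andP: hg => g1 _; rewrite gt_eqF // (lt_trans ltr01).
apply: (mulIf g0); rewrite divfK //.
transitivity (2 * ((2 - p) * (1 - p) * g + p * (2 - p)) + 2 * p * g).
  by rewrite /mu; ring.
by rewrite -hF; ring.
Qed.

Lemma mu_ge0 : 0 <= mu.
Proof.
have [p0 p1] := andP hp; have [g1 gb] := andP hg.
by rewrite /mu !addr_ge0 // ?mulr_ge0 //; lra.
Qed.

(** By [mu_div_g] both sides are affine in [g], and their coefficients agree as rational functions
    of [p]. *)
Lemma ratio_low : kappa_low + mu_low + 2 * (1 - p) ^+ 3 * p * (g - 1) = ratio.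
Proof.
have [p0 p1] := andP hp.
rewrite /ratio mu_div_g /kappa_low /mu_low /kappa; field.
by rewrite gt_eqF //; lra.
Qed.

Lemma mu_low_ge0 : 0 <= mu_low.
Proof.
have [p0 p1] := andP hp; have [g1 gb] := andP hg; have q0 : 0 < 1 - p by lra.
have g0 : 0 < g by lra.
have p2 : 0 < 2 - p by lra.
rewrite /mu_low; move: q0 p2; set q := 1 - p; set u := 2 - p => q0 u0.
clearbody q u.
by repeat (apply: addr_ge0 || apply: mulr_ge0 || apply: exprn_ge0); lra.
Qed.

Lemma detection_ratio_le d : 1 <= d ->
  (p%:E * expected_detection_time p w d <= (ratio * d)%:E)%E.
Proof.
move=> d1; have [p0 p1] := andP hp; have [g1 gb] := andP hg.
have [r /andP[rd dr]] := scale_exists d1.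
have [/andP[r0 dg]|hr] := boolP ((0 < r)%N && (d < g * b ^+ r)).
  case: r r0 dg rd {dr} => // s _ dg rd.
  apply: le_trans (@detection_low s d _) _; first by rewrite rd.
  rewrite lee_fin -ratio_low.
  have : 0 <= mu_low * (d - b ^+ s.+1) by rewrite mulr_ge0 ?mu_low_ge0 ?subr_ge0.
  have : 0 <= (1 - p) ^+ 3 * p * (g - 1) * d.
    by rewrite !mulr_ge0 ?exprn_ge0 //; lra.
  by rewrite /ratio; lra.
have hr' : (0 < r)%N -> g * b ^+ r <= d.
  by move=> r0; rewrite r0 /= -leNgt in hr.
apply: le_trans (@detection_high r d _ hr') _; first by rewrite d1.
rewrite lee_fin /ratio.
have g0 : 0 < g by lra.
have mug0 : 0 <= mu / g by rewrite divr_ge0 ?mu_ge0 // ltW.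
case: r hr' {rd dr hr} => [_|s /(_ isT) xd].
  (* Round 0 lacks the bound g x_r <= d, so the term -2 g has to be spent: the right side exceeds
     the left by 2 p^2 q g + 2 q (g - p). *)
  have muE : mu - 2 * g <= mu / g.
    have : 0 <= p ^+ 2 * (1 - p) * g by rewrite !mulr_ge0 ?exprn_ge0 //; lra.
    have : 0 <= (1 - p) * (g - p) by rewrite mulr_ge0 ?subr_ge0 //; lra.
    by rewrite mu_div_g /mu; lra.
  have : 0 <= mu / g * (d - 1) by rewrite mulr_ge0 ?subr_ge0.
  by rewrite expr0; lra.
have : mu * b ^+ s.+1 = mu / g * (g * b ^+ s.+1).
  by rewrite mulrA divfK ?gt_eqF.
have : 0 <= mu / g * (d - g * b ^+ s.+1) by rewrite mulr_ge0 ?subr_ge0.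
lra.
Qed.

Lemma competitive_ratioE : competitive_ratio p w = ratio%:E.
Proof.
have [p0 p1] := andP hp; have [g1 gb] := andP hg.
have g0 : 0 < g by lra.
apply/eqP; rewrite eq_le; apply/andP; split.
  apply: ge_ereal_sup => _ [d /= d1 <-]; have d0 : 0 < d by lra.
  by rewrite lee_pdivrMr // detection_ratio_le.
apply/lee_addgt0Pr => e e0.
have mug0 : 0 <= mu / g by rewrite divr_ge0 ?mu_ge0 // ltW.
(* For d = g x + 1, substituting x = (d - 1) / g makes the cost exactly [ratio * d - C]. *)
pose C := mu / g + 2 * g; have C0 : 0 < C by rewrite /C; lra.
(* The first summand yields C / d < e; the second yields g x + 1 < b x, which keeps [d] below the
   next x_r. *)
have [n nM] := expb_unbounded (C / e + 1 / (b - g)).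
pose x := b ^+ n.+1; have xn : b ^+ n < x.
  by rewrite /x exprS ltr_pMl ?b_gt1 // (lt_le_trans ltr01 (x_ge1 n)).
have bg0 : 0 < b - g by rewrite subr_gt0.
have xC : C / e < x.
  by apply: le_lt_trans xn; apply: le_trans nM; rewrite lerDl divr_ge0 // ltW.
have xb : 1 < x * (b - g).
  rewrite -ltr_pdivrMr //; apply: le_lt_trans xn; apply: le_trans nM.
  by rewrite lerDr divr_ge0 // ltW.
have x1 : 1 <= x := x_ge1 n.+1.
pose d := g * x + 1; have xd : x <= d by rewrite /d; nra.
have d0 : 0 < d by lra.
have dr : g * b ^+ n.+1 < d < b ^+ n.+2.
  by rewrite [b ^+ n.+2]exprS -/x /d; lra.
apply: (@le_trans _ _ (((ratio - C / d)%:E) + e%:E)%E).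
  rewrite -EFinD lee_fin -addrA lerDl addrC subr_ge0 ler_pdivrMr //.
  by rewrite ltr_pdivrMr // in xC; nra.
rewrite leeD2r //; apply: ereal_sup_ubound; exists d => /=; first by lra.
rewrite (detection_high_eq (r := n.+1)) // -EFinM; congr EFin.
by rewrite /ratio /C -/x /d; field; rewrite !gt_eqF.
Qed.

End SubMonotone.

(** * Solving the quadratic equation for [g] *)

Theorem theorem4 (R : realType) (p : R) (hp : 0 < p < 1) :
  exists w : nat -> R,
    sub_monotone1 (1 / (1 - p)) w /\
    competitive_ratio p w =
      (Num.sqrt ((p - 2) * (p - 1) * (p * (p * (4 * p - 3) + 5) + 2))
       + 4 / (2 - p) - (2 - p) * p)%:E.
Proof.
have [p0 p1] := andP hp.
set D := (p - 2) * (p - 1) * _; set s := Num.sqrt D.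
have D0 : 0 <= D.
  have -> : D = (2 - p) * (1 - p) * (4 * p ^+ 3 + 3 * p * (1 - p) + 2 * p + 2).
    by rewrite /D; ring.
  have p3 : 0 < p ^+ 3 by rewrite exprn_gt0.
  have pq : 0 < p * (1 - p) by rewrite mulr_gt0 ?subr_gt0.
  by apply: mulr_ge0; [apply: mulr_ge0|]; lra.
have sD : s ^+ 2 = D by rewrite sqr_sqrtr.
have s0 : 0 <= s by exact: sqrtr_ge0.
pose A := (2 - p) * (1 - p); pose N := (1 - p) * (p ^+ 2 - p + 2).
have q0 : 0 < 1 - p by lra.
have p2 : 0 < p ^+ 2 by rewrite exprn_gt0.
have A0 : 0 < A by rewrite mulr_gt0 //; lra.
have N0 : 0 < N by rewrite mulr_gt0 //; lra.
pose g := (s + A) / (2 * N).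
have gE : 2 * N * g = s + A by rewrite mulrC divfK // gt_eqF // mulr_gt0.
have g0 : 0 < g by apply: divr_gt0; [exact: ltr_wpDl|exact: mulr_gt0].
have hF : N * g ^+ 2 = A * g + p * (2 - p).
  have N4 : 4 * N != 0 by rewrite gt_eqF // mulr_gt0.
  apply: (mulfI N4).
  have -> : 4 * N * (N * g ^+ 2) = (2 * N * g) ^+ 2 by ring.
  have -> : 4 * N * (A * g + p * (2 - p)) =
    2 * A * (2 * N * g) + 4 * N * (p * (2 - p)) by ring.
  by rewrite gE sqrrD sD /D /A /N; ring.
have gN : g * (N * g - A) = p * (2 - p).
  by transitivity (N * g ^+ 2 - A * g); [ring | rewrite hF; ring].
have NgA : 0 < N * g - A.
  by rewrite -(pmulr_rgt0 _ g0) gN mulr_gt0 //; lra.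
have g1 : 1 < g.
  (* If g <= 1, then p (2 - p) = g (N g - A) <= N - A = p^2 q, which is too small. *)
  rewrite ltNge; apply/negP => g1.
  have : p * (2 - p) <= N * g - A by rewrite -gN ler_piMl // ltW.
  have : N * g <= N by rewrite ler_piMr // ltW.
  have : 0 < p * (1 - p) + p * p ^+ 2 by rewrite addr_gt0 ?mulr_gt0.
  rewrite /N /A; nra.
pose b := 1 / (1 - p).
have qb : (1 - p) * b = 1 by rewrite /b mul1r divff // gt_eqF.
have b1 : 1 < b by rewrite ltr_pdivlMr //; lra.
have gb : g < b.
  (* If b <= g, then N g - A >= N b - A = 2 p, while g > 1 forces N g - A <= p (2 - p) < 2 p. *)
  rewrite ltNge; apply/negP => bg.
  have : N * b <= N * g by rewrite ler_pM2l.
  have -> : N * b = p ^+ 2 - p + 2 by rewrite /N mulrAC qb mul1r.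
  have : N * g - A <= p * (2 - p) by rewrite -gN ler_peMl // ltW.
  rewrite /A; nra.
have hg : 1 < g < b by rewrite g1.
exists (sub_monotone1_path b g); split; first by split=> //; exists g.
have kp : 2 * g / p * p = 2 * g by rewrite divfK // gt_eqF.
rewrite (competitive_ratioE hp qb hg kp hF); congr EFin.
rewrite (mu_div_g hg hF) -/N -/A /kappa.
have -> : 2 * (1 - p) * (p ^+ 2 - p + 2) * g = s + A by rewrite -gE /N; ring.
by rewrite /A; field; rewrite gt_eqF //; lra.
Qed.
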